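(* Consider the parking process on $\mathbb{Z}$ with parameter $p$, and let $\tau$ be the parking time of the car starting at $0$ (with $\tau=0$ if $0$ is initially a parking space). If $p<1/2$ then $\mathbb{E}[\tau]<\infty$. Moreover, $\mathbb{E}[\tau]=O\left((1/2-p)^{-6}\right)$ as $p\nearrow 1/2$.
   Context: The parking process on $\mathbb{Z}$ with parameter $p\in[0,1]$. Independently for each $v\in\mathbb{Z}$ let: $X^v=(X^v_0,X^v_1,\dots)$ be a simple symmetric random walk on $\mathbb{Z}$ with $X^v_0=v$ (steps $\pm1$ with probability $1/2$ each); $(U^v_s)_{s\in\mathbb{N}}$ be i.i.d. uniform random variables on $[0,1]$; $B^v$ be a Bernoulli($p$) random variable; all of these are independent. At time $0$ there is a car at $v$ if $B^v=1$, and otherwise $v$ is a parking space with capacity for one car. The car starting at $v$ follows the walk $X^v$ (all cars moving simultaneously at times $1,2,\dots$) until it arrives at a free parking space, where it parks permanently. If several cars arrive at the same free parking space at time $s$, the car $u$ among them with the smallest $U^u_s$ parks there and the others continue. Let $\tau^v=0$ if $v$ is initially a parking space; otherwise $\tau^v$ is the time at which the car starting at $v$ parks ($\tau^v=\infty$ if it never parks). Write $\tau=\tau^0$. *)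

(* Defs.v *)
From HB Require Import structures.
From mathcomp Require Export all_boot all_order all_algebra.
From mathcomp Require Export finmap.
From mathcomp Require Export all_classical all_reals all_analysis.
Export Order.TTheory GRing.Theory Num.Theory.
Export numFieldNormedType.Exports.

Set Implicit Arguments.
Unset Strict Implicit.
Unset Printing Implicit Defensive.

Local Open Scope classical_set_scope.
Local Open Scope ring_scope.

HB.instance Definition _ := isPointed.Build int 0.

HB.instance Definition _ := @isMeasurable.Build default_measure_display int
  discrete_measurable discrete_measurable0 discrete_measurableC
  discrete_measurableU.

(* One realisation of the process: [X v s] is the position at time [s] of the
   walk of [v], [U v s] its tie-breaking mark and [B v] holds iff there is a
   car at [v] at time 0. *)
Section dynamics.
Context {R : realType}.
Variables (X : int -> nat -> int) (U : int -> nat -> R) (B : int -> bool).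

(* [parks D F s v]: the car [v] parks at time [s], where [D] is the set of
   cars still driving and [F] the set of spaces still free just before the
   moves of time [s]. If the smallest mark is shared by several cars, none of
   them parks; with continuous marks this has probability 0. *)
Definition parks (D F : set int) (s : nat) (v : int) : Prop :=
  [/\ D v, F (X v s) &
      forall u, D u -> X u s = X v s -> u <> v -> U v s < U u s].

(* (cars still driving, spaces still free) after the moves of time [s] *)
Fixpoint state (s : nat) : set int * set int :=
  if s is s'.+1 then
    let: (D, F) := state s' in
    let P := [set v | parks D F s v] in
    (D `\` P, F `\` [set X v s | v in P])
  else ([set v | B v], [set v | ~~ B v]).

(* [v] parks at time [s.+1]; nobody parks at time 0. *)
Definition parks_at (s : nat) (v : int) : Prop :=
  parks (state s).1 (state s).2 s.+1 v.

(* A car parks at most once, so the infimum selects its parking time; it is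
   [+oo] if the car never parks. *)
Definition parking_time (v : int) : \bar R :=
  if B v then ereal_inf [set s.+1%:R%:E | s in [set s | parks_at s v]]
  else 0%E.

End dynamics.

Section probability.
Context {R : realType} {d : measure_display} {Omega : measurableType d}.
Variable P : probability Omega R.

Definition mutually_independent (I : choiceType) (F : I -> set_system Omega) :=
  forall (J : {fset I}) (A : I -> set Omega),
    (forall i, i \in J -> F i (A i)) ->
    P (\bigcap_(i in [set` J]) A i) = (\prod_(i <- J) P (A i))%E.

Variables (X : int -> nat -> {RV P >-> int}) (U : int -> nat -> {RV P >-> R})
  (B : int -> {RV P >-> bool}).

Definition step (v : int) (s : nat) (w : Omega) : int := X v s.+1 w - X v s w.

(* The sigma-algebras generated by the steps, the marks and the occupations. *)
Definition sources (i : int * nat + int * nat + int) : set_system Omega :=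
  match i with
  | inl (inl (v, s)) => preimage_set_system setT (step v s) measurable
  | inl (inr (v, s)) => preimage_set_system setT (U v s) measurable
  | inr v => preimage_set_system setT (B v) measurable
  end.

(* The walks are simple symmetric random walks: [X v] starts at [v] and has
   independent steps with values 1 and -1 with probability 1/2 each. The law of
   a mark is only specified on measurable sets, as [P] carries no information
   on the others. *)
Record parking_process (p : R) : Prop := ParkingProcess {
  parameter_range : 0 <= p <= 1;
  walk_start : forall v w, X v 0 w = v;
  step_right : forall v s, P [set w | step v s w = 1] = 2^-1%:E;
  step_left : forall v s, P [set w | step v s w = -1] = 2^-1%:E;
  mark_law : forall v s A, measurable A ->
    distribution P (U v s) A = uniform_prob (@ltr01 R) A;
  occupation_law : forall v, distribution P (B v) = bernoulli_prob p;
  all_independent : mutually_independent sources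
}.

Definition tau (w : Omega) : \bar R :=
  parking_time (fun v s => X v s w) (fun v s => U v s w) (fun v => B v w) 0.

End probability.

(* Main.v *)
(* If the car of 0 still drives at time t, then no site of its path is free at
   time t. Let ]l, r[ be the interval between the free sites nearest to 0 on
   both sides. Until time t no car enters a free site that stays free, so no car
   crosses l or r: the walk of 0 has stayed in ]l, r[, and the spaces of ]l, r[
   were all filled by cars starting there, so that it contains at least as many
   cars as spaces. By symmetry let n = r >= -l. Then the walk has stayed in
   ]-n, n[, and read from n-1 downwards some stretch of at least n sites of
   ]-n, n[ has no more spaces than cars. With dl = 1/2 - p, z = 1 - dl and
   rho = 1 - dl^2, the mean of z^(spaces - cars) loses a factor rho at each site,
   so by the maximal inequality the latter event has probability at most rho^n.
   It is independent of the walk of 0, whose exit time from ]-n, n[ has mean n^2.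
   Summing over t, over n and over the two sides,
   E tau <= 2 sum_n n^2 rho^n <= 4 dl^(-6). *)
Require Import Defs.
From mathcomp Require Import measurable_realfun.
From mathcomp Require Import zify ring lra.

Set Implicit Arguments.
Unset Strict Implicit.
Unset Printing Implicit Defensive.

Local Open Scope classical_set_scope.
Local Open Scope ring_scope.

(** * Independent bits *)

Section independent_bits.
Context {R : realType}.

(** The law of independent bits, the i-th being true with probability the i-th entry of [ps].
    Conditioning on the first bit turns estimates into inductions on lists. *)
Fixpoint bits_prob (ps : seq R) (phi : pred (seq bool)) : R :=
  if ps is p :: ps' then
    p * bits_prob ps' (phi \o cons true)
    + (1 - p) * bits_prob ps' (phi \o cons false)
  else (phi [::])%:R.

Definition is_prob (p : R) := 0 <= p <= 1.

Lemma eq_bits_prob ps (phi psi : pred (seq bool)) :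
  phi =1 psi -> bits_prob ps phi = bits_prob ps psi.
Proof.
elim: ps phi psi => [|p ps IH] phi psi e /=; first by rewrite e.
by congr (_ * _ + _ * _); apply: IH => l /=; rewrite e.
Qed.

Lemma bits_prob_pred0 ps : bits_prob ps pred0 = 0.
Proof.
elim: ps => [//|p ps IH] /=.
by rewrite !(@eq_bits_prob _ _ pred0) // IH !mulr0 addr0.
Qed.

Lemma bits_prob_ge0 ps phi : all is_prob ps -> 0 <= bits_prob ps phi.
Proof.
elim: ps phi => [|p ps IH] phi /=; first by rewrite ler0n.
case/andP=> /andP[p0 p1] /IH h.
by rewrite addr_ge0 // mulr_ge0 ?h // subr_ge0.
Qed.

Lemma bits_prob_le1 ps phi : all is_prob ps -> bits_prob ps phi <= 1.
Proof.
elim: ps phi => [|p ps IH] phi /=; first by rewrite lern1 leq_b1.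
case/andP=> /andP[p0 p1] /IH h.
rewrite [leRHS](_ : 1 = p * 1 + (1 - p) * 1); last by ring.
by rewrite lerD // ler_wpM2l ?h // subr_ge0.
Qed.

(** Independence of two consecutive blocks; it later separates the occupations from the walk. *)
Lemma bits_prob_cat ps qs phi psi :
  bits_prob (ps ++ qs)
    (fun l => phi (take (size ps) l) && psi (drop (size ps) l))
  = bits_prob ps phi * bits_prob qs psi.
Proof.
elim: ps phi => [|p ps IH] phi /=.
  rewrite (@eq_bits_prob qs _ (fun l => phi [::] && psi l)); last first.
    by move=> l; rewrite take0 drop0.
  case: (phi [::]) => /=; first by rewrite mul1r.
  by rewrite mul0r (@eq_bits_prob _ _ pred0) // bits_prob_pred0.
rewrite [RHS]mulrDl -!mulrA -!IH; congr (_ * _ + _ * _); exact: eq_bits_prob.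
Qed.

(* With [c] cars and [s] spaces already counted: some prefix of [l] of length
   at least [j] brings the number of cars up to the number of spaces. *)
Fixpoint crowded (j c s : nat) (l : seq bool) : bool :=
  ((j == 0) && (s <= c))%N ||
  if l is x :: l' then crowded j.-1 (c + x) (s + ~~ x) l' else false.

Lemma crowded_take j c s l k : (j <= k <= size l)%N ->
  (s + count negb (take k l) <= c + count id (take k l))%N ->
  crowded j c s l.
Proof.
elim: l j c s k => [|x l IH] j c s k /=.
  move=> /andP[jk]; rewrite leqn0 => /eqP k0.
  by move: jk; rewrite k0 leqn0 => ->; rewrite !addn0 => ->.
case: k => [|k] /=; first by rewrite leqn0 => /andP[-> _]; rewrite !addn0 => ->.
move=> /andP[jk kl] h; apply/orP; right.
by apply: (IH _ _ _ k); [lia|rewrite -!addnA].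
Qed.

(* Maximal inequality for the supermartingale [z ^ (spaces - cars)]. *)
Lemma crowded_prob (p z rho : R) n j c s : is_prob p -> 0 < z <= 1 ->
  0 <= rho <= 1 -> p + (1 - p) * z ^+ 2 <= rho * z ->
  bits_prob (nseq n p) (crowded j c s) * z ^+ c <= rho ^+ j * z ^+ s.
Proof.
move=> pP /andP[z0 z1] /andP[r0 r1] hz.
have z0' := ltW z0.
have le1 n' phi : bits_prob (nseq n' p) phi <= 1.
  by apply: bits_prob_le1; rewrite all_nseq pP orbT.
have ge0 n' phi : 0 <= bits_prob (nseq n' p) phi.
  by apply: bits_prob_ge0; rewrite all_nseq pP orbT.
(* Once the cars have caught up with the spaces, [z <= 1] settles the bound whatever the remaining
   bits are. *)
have now c' s' n' phi : (s' <= c')%N ->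
    bits_prob (nseq n' p) phi * z ^+ c' <= z ^+ s'.
  move=> sc; apply: (@le_trans _ _ (z ^+ c')).
    by rewrite ler_piMl ?exprn_ge0.
  by rewrite ler_wiXn2l.
elim: n j c s => [|n IH] j c s.
  rewrite /= orbF; have [/andP[/eqP -> sc]|h] := boolP (_ && _).
    by rewrite !mul1r ler_wiXn2l.
  by rewrite mul0r mulr_ge0 ?exprn_ge0.
have [/andP[/eqP -> sc]|jc] := boolP ((j == 0) && (s <= c))%N.
  by rewrite expr0 mul1r; apply: now.
rewrite /= [X in p * X](@eq_bits_prob _ _ (crowded j.-1 c.+1 s)); last first.
  by move=> l /=; rewrite (negbTE jc) addn1 addn0.
rewrite [X in (1 - p) * X](@eq_bits_prob _ _ (crowded j.-1 c s.+1)); last first.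
  by move=> l /=; rewrite (negbTE jc) addn1 addn0.
set a := bits_prob _ _; set b := bits_prob _ _.
have ha : a * z ^+ c.+1 <= rho ^+ j.-1 * z ^+ s := IH _ _ _.
have hb : b * z ^+ c <= rho ^+ j.-1 * z ^+ s.+1 := IH _ _ _.
(* At [j = 0] the predecessor is again 0, and [rho <= 1] makes up for the missing factor. *)
have hr : rho ^+ j.-1 * rho <= rho ^+ j.
  by case: (j) => [|j'] /=; rewrite ?expr0 ?mul1r // -exprSr.
(* The extra factor [z] provides the power [z ^+ c.+1] needed after a car. *)
rewrite -(ler_pM2r z0).
have zs : 0 <= z ^+ s by rewrite exprn_ge0.
case/andP: pP => p0 p1.
apply: (@le_trans _ _ (rho ^+ j.-1 * z ^+ s * (p + (1 - p) * z ^+ 2))).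
  have -> : (p * a + (1 - p) * b) * z ^+ c * z
     = p * (a * z ^+ c.+1) + (1 - p) * z * (b * z ^+ c) by rewrite (exprS z c); ring.
  have -> : rho ^+ j.-1 * z ^+ s * (p + (1 - p) * z ^+ 2)
     = p * (rho ^+ j.-1 * z ^+ s) + (1 - p) * z * (rho ^+ j.-1 * z ^+ s.+1).
     by rewrite (exprS z s); ring.
  by rewrite lerD // ler_wpM2l // mulr_ge0 ?subr_ge0 //.
apply: (@le_trans _ _ (rho ^+ j.-1 * z ^+ s * (rho * z))).
  by rewrite ler_wpM2l // mulr_ge0 ?exprn_ge0.
have -> : rho ^+ j.-1 * z ^+ s * (rho * z) = (rho ^+ j.-1 * rho) * z ^+ s * z.
  by ring.
by rewrite ler_wpM2r // ler_wpM2r.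
Qed.

(** A walk from [y], going up at [true], that remains strictly between 0 and [M] up to its last
    position. The truncation in [y.-1] is harmless since [0 < y] is tested first. *)
Fixpoint stays (M y : nat) (l : seq bool) : bool :=
  (0 < y < M)%N &&
  if l is x :: l' then stays M (if x then y.+1 else y.-1) l' else true.

(* Gambler's ruin: [y (M - y)] is the expected exit time from [y]. *)
Lemma stays_time (M y n : nat) : (y <= M)%N ->
  \sum_(t < n) bits_prob (nseq t (2^-1 : R)) (stays M y) <= (y * (M - y))%:R.
Proof.
elim: n y => [|n IH] y yM; first by rewrite big_ord0 ler0n.
have [/andP[y0 yM'] |yout] := boolP (0 < y < M)%N; last first.
  rewrite big1 ?ler0n // => t _.
  rewrite (@eq_bits_prob _ _ pred0) ?bits_prob_pred0 // => l.
  by case: l => [|x l] /=; rewrite (negbTE yout).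
rewrite big_ord_recl /= y0 yM' /=.
under eq_bigr => t _.
  rewrite [X in 2^-1 * X](@eq_bits_prob _ _ (stays M y.+1)); last first.
    by move=> l /=; rewrite y0 yM'.
  rewrite [X in (1 - 2^-1) * X](@eq_bits_prob _ _ (stays M y.-1)); last first.
    by move=> l /=; rewrite y0 yM'.
  over.
rewrite big_split /= -!mulr_sumr.
have h1 := IH y.+1 yM'.
have h2 : _ <= _ := IH y.-1 (leq_trans (leq_pred _) yM).
(* The mean of [y (M - y)] over the two neighbours is one less than its value at [y]; this one pays
   for the term [t = 0]. *)
have e : ((y.+1 * (M - y.+1))%:R + (y.-1 * (M - y.-1))%:R + 2
    = (y * (M - y))%:R + (y * (M - y))%:R :> R).
  by rewrite -!natrD; congr (_%:R); case: (y) y0 yM' => // y' _ ?; nia.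
lra.
Qed.

(** The full series equals [rho (1 + rho) / (1 - rho)^3], and [rho (1 + rho) <= 2]. *)
Lemma sum_sq_geo (rho : R) n : 0 <= rho < 1 ->
  \sum_(k < n) rho ^+ k * (k * k)%:R <= 2 / (1 - rho) ^+ 3.
Proof.
move=> /andP[r0 r1].
have d0 : 0 < 1 - rho by rewrite subr_gt0.
rewrite ler_pdivlMr ?exprn_gt0 //.
(* The second term is [(1 - rho) ^ 3] times the tail of the series. *)
suff : (\sum_(k < n) rho ^+ k * (k * k)%:R) * (1 - rho) ^+ 3
  + rho ^+ n * (n%:R ^+ 2 * (1 - rho) ^+ 2 + 2 * n%:R * rho * (1 - rho)
       + rho * (1 + rho)) <= 2.
  have : 0 <= rho ^+ n * (n%:R ^+ 2 * (1 - rho) ^+ 2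
      + 2 * n%:R * rho * (1 - rho) + rho * (1 + rho)).
    move: (1 - rho) (ltW d0) => d {}d0.
    by rewrite ?(mulr_ge0, addr_ge0, exprn_ge0, ler0n).
  lra.
(* The left side does not depend on [n]; at [n = 0] it is [rho (1 + rho)]. *)
elim: n => [|n IH]; first by rewrite big_ord0 expr0; nra.
apply: le_trans IH; rewrite big_ord_recr /= (exprSr rho n) natrM -(natr1 n) le_eqVlt.
by apply/orP; left; apply/eqP; ring.
Qed.

End independent_bits.

(** * The dynamics for fixed walks, marks and occupations *)

(** The flag [e] selects the side: sites are read downwards from [k], or as the mirror image of
    this, so that one argument serves both sides of the origin. *)
Definition site (e : bool) (k : int) (i : nat) : int :=
  if e then k - i%:Z else i%:Z - k.

Definition sites e k n : seq int := map (site e k) (iota 0 n).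

Definition signed (e : bool) (x : int) : int := if e then x else - x.

Lemma mem_sites e k n x :
  (x \in sites e k n) = (k - n%:Z < signed e x <= k).
Proof.
apply/mapP/idP => [[i]|h]; first by rewrite mem_iota /site /signed; case: e; lia.
exists `|k - signed e x|%N; first by rewrite mem_iota; case: e h => /=; lia.
by rewrite /site; case: e h => /=; lia.
Qed.

Lemma sites_uniq e k n : uniq (sites e k n).
Proof.
by rewrite map_inj_uniq ?iota_uniq // /site => i j; case: e; lia.
Qed.

Lemma size_sites e k n : size (sites e k n) = n.
Proof. by rewrite size_map size_iota. Qed.

Lemma take_sites e k m n : (m <= n)%N -> take m (sites e k n) = sites e k m.
Proof. by move=> mn; rewrite /sites -map_take take_iota; congr map; congr iota; lia. Qed.

Section pathwise.
Context {R : realType}.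
Variables (X : int -> nat -> int) (U : int -> nat -> R) (B : int -> bool).
Hypothesis X0 : forall v, X v 0 = v.
Hypothesis X_step : forall v s, X v s.+1 - X v s = 1 \/ X v s.+1 - X v s = -1.
Hypothesis U_inj : forall s u v, u <> v -> U u s <> U v s.

Let driving s := (state X U B s).1.
Let free s := (state X U B s).2.

Lemma driving_S s v : driving s.+1 v <-> driving s v /\ ~ parks_at X U B s v.
Proof. by rewrite /driving /parks_at /=; case: (state X U B s). Qed.

Lemma free_S s x : free s.+1 x <->
  free s x /\ ~ exists2 v, parks_at X U B s v & X v s.+1 = x.
Proof. by rewrite /free /parks_at /=; case: (state X U B s). Qed.

Lemma driving_anti s t v : (s <= t)%N -> driving t v -> driving s v.
Proof.
elim: t => [|t IH]; first by rewrite leqn0 => /eqP->.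
by rewrite leq_eqVlt => /predU1P[-> //|st] /driving_S[/(IH st)].
Qed.

Lemma free_anti s t x : (s <= t)%N -> free t x -> free s x.
Proof.
elim: t => [|t IH]; first by rewrite leqn0 => /eqP->.
by rewrite leq_eqVlt => /predU1P[-> //|st] /free_S[/(IH st)].
Qed.

Lemma driving_car s v : driving s v -> B v.
Proof. exact: (@driving_anti 0). Qed.

Lemma parks_at_inj s s' v :
  parks_at X U B s v -> parks_at X U B s' v -> s = s'.
Proof.
wlog ss' : s s' / (s <= s')%N.
  by move=> h p p'; have [/h|/ltnW/h] := leqP s s'; [|symmetry]; auto.
move=> p [p' _ _]; apply/eqP; rewrite eqn_leq ss' leqNgt.
by apply/negP => /driving_anti/(_ p')/driving_S[].
Qed.

Lemma walk_bound v s : (`|X v s - v| <= s)%N.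
Proof.
elim: s => [|s IH]; first by rewrite X0 subrr.
by case: (X_step v s); lia.
Qed.

Lemma seq_min (I : eqType) (f : I -> R) (l : seq I) :
  l != [::] -> exists2 i, i \in l & forall j, j \in l -> f i <= f j.
Proof.
elim: l => // i l IH _; have [->|/IH[m ml mle]] := eqVneq l [::].
  by exists i; rewrite ?mem_head // => j; rewrite inE => /eqP->.
have [im|mi] := leP (f i) (f m).
  exists i; rewrite ?mem_head // => j; rewrite inE => /predU1P[-> //|/mle].
  exact: le_trans.
exists m; first by rewrite inE ml orbT.
by move=> j; rewrite inE => /predU1P[->|/mle //]; apply: ltW.
Qed.

(* Finitely many cars can arrive at a given site, so one of them has the
   strictly smallest mark. *)
Lemma arrival_fills s v : driving s v -> ~ free s.+1 (X v s.+1).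
Proof.
move=> dv fv; have fv' := free_anti (leqnSn s) fv.
set x := X v s.+1 in fv fv'.
(* A car at [x] at time [s.+1] started within distance [s.+1] of [x], so this window contains all of
   them. *)
pose l := [seq u <- sites true (x + s.+1%:Z) (2 * s.+1).+1 |
            `[< driving s u /\ X u s.+1 = x >]].
have lP u : driving s u -> X u s.+1 = x -> u \in l.
  move=> du ux; rewrite mem_filter mem_sites; apply/andP; split.
    exact/asboolP.
  by have := walk_bound u s.+1; rewrite ux /=; lia.
have l0 : l != [::].
  by apply/eqP => l0; have := lP v dv erefl; rewrite l0.
have [u ul umin] := seq_min (U^~ s.+1) l0.
move: ul; rewrite mem_filter => /andP[/asboolP[du ux] _].
have /free_S[_] := fv; apply; exists u => //; split => //.
  by rewrite ux.
move=> w dw wx /eqP wu; rewrite lt_neqAle umin ?andbT.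
  by apply/eqP => /U_inj; apply; apply/eqP; rewrite eq_sym.
by apply: lP; rewrite // wx.
Qed.

(** A visit at a positive time fills the site if it was still free, the starting site held a car,
    and no site becomes free again. *)
Lemma visited_not_free s t v : (s <= t)%N -> driving t v -> ~ free t (X v s).
Proof.
move=> st dv /(free_anti st); case: s st => [|s] st; last first.
  by apply: arrival_fills; apply: driving_anti dv; apply: ltnW.
by rewrite X0 /free /= (driving_car dv).
Qed.

(** * Counting filled spaces against cars *)

Lemma filled x t : ~ B x -> ~ free t x ->
  exists2 s, (s < t)%N & exists2 u, parks_at X U B s u & X u s.+1 = x.
Proof.
move=> Bx; elim: t => [|t IH] nf; first by case: nf; exact/negP.
have [ft|/IH[s st h]] := pselect (free t x); last by exists s => //; lia.
exists t => //; apply: contrapT => np; apply: nf.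
by apply/free_S.
Qed.

(** Send each filled space of [l] to the car that parked in it. This is injective because a car
    parks only once, and the car started in [l']. *)
Lemma spaces_le_cars (l l' : seq int) t : uniq l ->
  (forall x, x \in l -> ~ free t x) ->
  (forall u s, (s < t)%N -> parks_at X U B s u -> X u s.+1 \in l -> u \in l') ->
  (count (fun v => ~~ B v) l <= count B l')%N.
Proof.
move=> ul nf start.
(* Outside the spaces of [l] the value 0 is a dummy that makes the choice function total. *)
have ex x : exists u, x \in l -> ~~ B x ->
    exists2 s, (s < t)%N & parks_at X U B s u /\ X u s.+1 = x.
  have [xl|] := boolP (x \in l); last by exists 0.
  have [|nB] := boolP (B x); first by exists 0.
  have [s st [u pu ux]] := filled (elimN idP nB) (nf _ xl).
  by exists u => _ _; exists s.
have [f fP] := choice ex.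
rewrite -!size_filter -(size_map f).
apply: uniq_leq_size.
  rewrite map_inj_in_uniq ?filter_uniq // => x y.
  rewrite !mem_filter => /andP[Bx xl] /andP[By yl] fxy.
  have [s st [ps sx]] := fP x xl Bx; have [s' st' [ps' sy]] := fP y yl By.
  by rewrite -sx -sy fxy; rewrite fxy in ps; rewrite (parks_at_inj ps ps').
move=> u /mapP[x]; rewrite mem_filter => /andP[Bx xl] ->.
have [s st [ps sx]] := fP x xl Bx.
rewrite mem_filter; apply/andP; split.
  by case: ps => d _ _; apply: driving_car d.
by apply: (start _ s) => //; rewrite sx.
Qed.

(** * Free sites as barriers *)

(** With steps of size 1, changing sides of [c] requires a visit to [c]. *)
Lemma no_crossing v c s : (forall r, (r < s)%N -> X v r <> c) ->
  X v s <> c -> (X v s < c) = (v < c).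
Proof.
elim: s => [|s IH] h hs; first by rewrite X0.
rewrite -IH; first by have := h s (ltnSn s); case: (X_step v s); lia.
  by move=> r rs; apply: h; lia.
exact: h.
Qed.

Lemma driving_no_crossing v c s t : (s <= t)%N -> driving t v -> free t c ->
  (X v s < c) = (v < c).
Proof.
by move=> st dv fc; apply: no_crossing => [r rs|] e;
  [apply: (@visited_not_free r t v); rewrite ?e //; lia
  |apply: (@visited_not_free s t v); rewrite ?e].
Qed.

(** All sites visited before parking are filled by then, and the parking site is filled from that
    moment on; hence none of them is [c]. *)
Lemma parking_no_crossing v c s t : (s < t)%N -> parks_at X U B s v ->
  free t c -> (X v s.+1 < c) = (v < c).
Proof.
move=> st pv fc; have [dv _ _] := pv; apply: no_crossing => [r rs|] e.
  apply: (@visited_not_free r s v) => //; rewrite e.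
  by apply: free_anti fc; apply: ltnW.
have /free_S[_] : free s.+1 c by apply: free_anti fc.
by apply; exists v.
Qed.

(* The second alternative covers the case where every site on one side of the
   origin is filled at time [t]; it has probability 0. *)
Lemma still_driving t : driving t 0 -> exists e : bool,
  (exists n : nat,
     crowded n 0 0 (map B (sites e (n%:Z - 1) (2 * n).-1)) /\
     forall s, (s <= t)%N -> - n%:Z < X 0 s < n%:Z) \/
  (forall n : nat, crowded (n + 2 * t).+1 (2 * t) 0
     (map B (sites e (n + t)%:Z (n + 2 * t).+1))).
Proof.
move=> d0.
have cars l : count id (map B l) = count B l by rewrite count_map.
have spaces l : count negb (map B l) = count (fun v => ~~ B v) l.
  by rewrite count_map.
have [[e nf]|] := pselect (exists e, forall n : nat, ~ free t (signed e n%:Z)).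
  exists e; right => n; set L := (n + 2 * t).+1.
  apply: (@crowded_take _ _ _ _ L); first by rewrite size_map size_sites !leqnn.
  rewrite take_oversize; last by rewrite size_map size_sites.
  rewrite add0n cars spaces.
  (* The sites from 0 to [n] on the filled side. Cars parked there by time [t] started at most [t]
     away, hence in the window of [L] sites from [-t] to [n + t]. *)
  pose l := sites e n%:Z n.+1.
  have h : (count (fun v => ~~ B v) l <= count B (sites e (n + t)%:Z L))%N.
    apply: (@spaces_le_cars _ _ t); first exact: sites_uniq.
      move=> x; rewrite mem_sites => xn; have -> : x = signed e `|x|%N%:Z.
        by case: e xn {nf l} => /=; lia.
      exact: nf.
    move=> u s st _; rewrite !mem_sites; have := walk_bound u s.+1.
    by case: (e) => /=; lia.
  (* The two margins of [t] sites add at most [2 * t] spaces, which the initial credit of [2 * t]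
     cars absorbs. *)
  have : (count (fun v => ~~ B v) (sites e (n + t)%:Z L)
      <= 2 * t + count (fun v => ~~ B v) l)%N.
    rewrite /sites /L (_ : (n + 2 * t).+1 = t + (n.+1 + t))%N; last by lia.
    rewrite iotaD map_cat count_cat iotaD map_cat count_cat !add0n.
    have -> : [seq site e (n + t)%:Z i | i <- iota t n.+1] = l.
      rewrite -[t in iota t _]addn0 iotaDl -map_comp; apply: eq_map => i /=.
      by rewrite /site; case: (e); lia.
    have := count_size (fun v => ~~ B v) [seq site e (n + t)%:Z i | i <- iota 0 t].
    have := count_size (fun v => ~~ B v)
      [seq site e (n + t)%:Z i | i <- iota (t + n.+1) t].
    rewrite !size_map !size_iota; do 3!move: (count _ _) => ?; lia.
  move: h; do 3!move: (count _ _) => ?; lia.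
move=> /forallNP nall.
have ex e : exists n : nat, `[< free t (signed e n%:Z) >].
  by have /existsNP[n /contrapT h] := nall e; exists n; apply/asboolP.
have min e : exists n : nat, [/\ (0 < n)%N, free t (signed e n%:Z) &
    forall m : nat, (m < n)%N -> ~ free t (signed e m%:Z)].
  have := ex_minnP (ex e); case=> n /asboolP fn nmin; exists n; split => //.
    rewrite lt0n; apply/eqP => n0; apply: (@visited_not_free 0 t 0) => //.
    by rewrite X0; move: fn; rewrite n0; case: (e).
  by move=> m mn fm; have := nmin m (introT (asboolP _) fm); lia.
have [np [np0 fp minp]] := min true; have [nm [nm0 fm minm]] := min false.
(* The side [e] is chosen so that [n] is the distance of the farther of the two nearest free
   sites. *)
have [e [n [n' [n0 [n'0 [n'n [fn fn' nfree]]]]]]] : exists e (n n' : nat),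
    (0 < n)%N /\ (0 < n')%N /\ (n' <= n)%N /\ [/\ free t (signed e n%:Z),
    free t (signed e (- n'%:Z)) &
    forall x, - n'%:Z < signed e x < n%:Z -> ~ free t x].
  have nfree x : - nm%:Z < x < np%:Z -> ~ free t x.
    case: x => k h; first by apply: minp; lia.
    by have := minm k.+1 ltac:(lia); rewrite /signed NegzE.
  have [le|/ltnW le] := leqP nm np.
    by exists true, np, nm; split => //; do 2?split => //; split.
  exists false, nm, np; split => //; do 2?split => //; split => //.
    by rewrite /signed opprK.
  by move=> x h; apply: nfree; move: h; rewrite /signed; lia.
exists e; left; exists n; split; last first.
  move=> s st.
  have h1 := driving_no_crossing st d0 fn.
  have h2 := driving_no_crossing st d0 fn'.
  have h3 : X 0 s <> signed e n%:Z.
    by move=> eq; apply: (@visited_not_free s t 0) => //; rewrite eq.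
  have h4 : X 0 s <> signed e (- n'%:Z).
    by move=> eq; apply: (@visited_not_free s t 0) => //; rewrite eq.
  by move: h1 h2 h3 h4; rewrite /signed; case: (e); lia.
(* The stretch strictly between the two free sites: at least [n] sites as [0 < n'], at most
   [2 n - 1] as [n' <= n]. *)
apply: (@crowded_take _ _ _ _ (n + n').-1).
  by rewrite size_map size_sites; lia.
rewrite !add0n -map_take take_sites; last by lia.
rewrite cars spaces.
apply: (@spaces_le_cars _ _ t); first exact: sites_uniq.
  by move=> x; rewrite mem_sites => h; apply: nfree; lia.
(* A car that parks inside the stretch crossed neither barrier and did not start on one, so it
   started inside. *)
move=> u s st pu; rewrite !mem_sites.
have h1 := parking_no_crossing st pu fn.
have h2 := parking_no_crossing st pu fn'.
have h3 c : free t c -> X u s.+1 <> c.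
  by move=> fc eq; have /free_S[_] := free_anti st fc; apply; exists u.
move: h1 h2 (h3 _ fn) (h3 _ fn').
have h5 c : free t c -> u <> c.
  move=> fc eq; case: pu => du _ _; have := driving_car du.
  by have := free_anti (leq0n t) fc; rewrite /free /= eq => /negP.
move: (h5 _ fn) (h5 _ fn').
by rewrite /signed; case: (e); lia.
Qed.

Lemma parking_time_le t :
  ~ driving t 0 -> (parking_time X U B 0 <= t%:R%:E :> \bar R)%E.
Proof.
move=> nd; rewrite /parking_time; case: ifPn => [B0|];
  last by rewrite lee_fin ler0n.
have [s st ps] : exists2 s, (s < t)%N & parks_at X U B s 0.
  elim: t nd => [|t IH] nd; first by case: nd.
  have [ps|nps] := pselect (parks_at X U B t 0); first by exists t.
  have [|s st ps] := IH; last by exists s => //; lia.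
  by move=> dt; apply: nd; apply/driving_S.
apply: (@le_trans _ _ s.+1%:R%:E); last by rewrite lee_fin ler_nat.
by apply: ereal_inf_lbound; exists s.
Qed.

(** A shift by [n] carries []-n, n[] to []0, 2 n[]; the starting time [s0] is left general for the
    induction. *)
Lemma stays_walk n v s0 t :
  (forall s, (s0 <= s <= s0 + t)%N -> - n%:Z < X v s < n%:Z) ->
  stays (2 * n) (absz (X v s0 + n%:Z))
    [seq X v s.+1 - X v s == 1 | s <- iota s0 t].
Proof.
elim: t s0 => [|t IH] s0 h; have hs0 := h s0 ltac:(lia);
  first by rewrite /=; lia.
rewrite /=; apply/andP; split; first by lia.
have := IH s0.+1 (fun s hs => h s ltac:(lia)).
congr (stays _ _ _).
by case: (X_step v s0) => e; rewrite e; case: eqP; lia.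
Qed.

End pathwise.

(** * Probability spaces *)

Section measure_lemmas.
Context {R : realType} {d : measure_display} {T : measurableType d}.
Variable P : probability T R.

(** Intersect covers of measure at most [1 / (n + 1)]. *)
Lemma negligible_small (N : set T) :
  (forall eps : R, 0 < eps ->
     exists A, [/\ measurable A, N `<=` A & (P A <= eps%:E)%E]) ->
  P.-negligible N.
Proof.
move=> h; have /choice[A hA] (n : nat) : exists A, [/\ measurable A, N `<=` A &
    (P A <= n.+1%:R^-1%:E)%E] by apply: h; rewrite invr_gt0.
have mA : measurable (\bigcap_n A n).
  by apply: bigcapT_measurable => n; case: (hA n).
exists (\bigcap_n A n); split=> //;
  last by move=> w Nw n _; case: (hA n) => _ /(_ w Nw).
apply/eqP; rewrite eq_le measure_ge0 andbT; apply/lee_addgt0Pr => e e0.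
rewrite add0e.
have [n ne] : exists n : nat, n.+1%:R^-1 <= e.
  exists (Num.truncn e^-1); rewrite -[leRHS]invrK lef_pV2 ?posrE ?invr_gt0 //.
  by have /andP[_ /ltW] := truncn_itv (ltW (etrans (invr_gt0 e) e0)).
have [mAn _ Pn] := hA n.
apply: (@le_trans _ _ (P (A n))).
  by apply: le_measure; rewrite ?inE // => w; apply.
by apply: (le_trans Pn); rewrite lee_fin.
Qed.

Lemma nneseries_le (a : nat -> \bar R) (c : \bar R) :
  (forall n, 0 <= a n)%E -> (forall n, \sum_(0 <= i < n) a i <= c)%E ->
  (\sum_(0 <= i <oo) a i <= c)%E.
Proof.
move=> a0 h; apply: lime_le; first exact: is_cvg_nneseries.
by apply: nearW => n; apply: h.
Qed.

(* [f] need not be measurable: its integral is then a lower one. *)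
Lemma integral_tail_sum (f : T -> \bar R) (E : nat -> set T) :
  (forall w, 0 <= f w)%E -> (forall t, measurable (E t)) ->
  (forall t w, ~ E t w -> f w <= t%:R%:E)%E ->
  (\int[P]_w f w <= \sum_(0 <= t <oo) P (E t))%E.
Proof.
move=> f0 mE fE.
have -> : (\sum_(0 <= t <oo) P (E t) =
    \int[P]_w \sum_(0 <= t <oo) (\1_(E t) w)%:E)%E.
  rewrite integral_nneseries //; last first.
  - by move=> n; apply/measurable_EFinP; exact: measurable_indic.
  by apply: eq_eseriesr => t _; rewrite integral_indic // setIT.
have g0 w : (0 <= \sum_(0 <= t <oo) (\1_(E t) w : R)%:E)%E.
  by apply: nneseries_ge0 => t _ _; rewrite lee_fin.
(* Both integrals are suprema over simple functions below the integrand, so a pointwise comparison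
   suffices. *)
rewrite !ge0_integralTE //; apply: ge_ereal_sup => _ [h /= hf <-].
apply: ereal_sup_ubound; exists h => //= w; apply: (le_trans (hf w)).
(* This will be used with [n] the first index such that [w] is outside [E n], where [fE] gives
   [f w <= n]. *)
have ge n : (forall i, (i < n)%N -> E i w) ->
    (n%:R%:E <= \sum_(0 <= t <oo) (\1_(E t) w : R)%:E)%E.
  move=> En; apply: (@le_trans _ _ (\sum_(0 <= i < n) (\1_(E i) w : R)%:E)%E).
    rewrite sumEFin lee_fin big_nat (eq_bigr (fun=> 1)).
      by rewrite -big_nat big_const_nat subn0 iter_addr_0.
    by move=> i it; rewrite indicE mem_set //; apply: En.
  by apply: nneseries_lim_ge => i _ _; rewrite lee_fin.
have [allE|/existsNP[t0 nE]] := pselect (forall t, E t w).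
  rewrite (_ : limn _ = +oo%E) ?leey //; apply/eqyP => A A0.
  apply: le_trans (ge (Num.truncn A).+1 _) => //; rewrite lee_fin ltW //.
  by have /andP[] := truncn_itv (ltW A0).
have ex : exists t, `[< ~ E t w >] by exists t0; apply/asboolP.
have [t /asboolP nEt tmin] := ex_minnP ex.
apply: (le_trans (fE _ _ nEt)); apply: ge => i it; apply: contrapT => nEi.
by have := tmin i (introT (asboolP _) nEi); lia.
Qed.

Lemma mutually_independent2 (I : choiceType) (F : I -> set_system T)
    (i j : I) (A A' : set T) :
  mutually_independent P F -> i != j -> F i A -> F j A' ->
  P (A `&` A') = (P A * P A')%E.
Proof.
move=> ind ij FA FA'; pose C k := if k == i then A else A'.
have Ci : C i = A by rewrite /C eqxx.
have Cj : C j = A' by rewrite /C eq_sym (negbTE ij).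
have := ind [fset i; j]%fset C; rewrite big_fsetU1 ?inE //= big_seq_fset1 Ci Cj => <-.
  congr (P _); apply/seteqP; split => w /=.
    by case=> Aw A'w k /=; rewrite !inE => /orP[]/eqP->; rewrite ?Ci ?Cj.
  by move=> h; split; [rewrite -Ci|rewrite -Cj]; apply: h; rewrite /= !inE eqxx ?orbT.
by move=> k; rewrite !inE => /orP[]/eqP->; rewrite ?Ci ?Cj.
Qed.

(** * The joint law of finitely many independent bits *)

Variable I : choiceType.
Variable e : I -> T -> bool.
Hypothesis me : forall i, measurable [set w | e i w].

Let split_bits (phi : pred (seq bool)) i js :
  [set w | phi [seq e j w | j <- i :: js]] =
  ([set w | e i w] `&` [set w | (phi \o cons true) [seq e j w | j <- js]]) `|`
  (~` [set w | e i w] `&` [set w | (phi \o cons false) [seq e j w | j <- js]]).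
Proof.
apply/seteqP; split => w /=; first by case: (e i w) => ?; [left|right].
by case => -[]; case: (e i w) => // /(_ isT).
Qed.

Lemma measurable_bits (phi : pred (seq bool)) js :
  measurable [set w | phi [seq e j w | j <- js]].
Proof.
elim: js phi => [|i js IH] phi.
  case: (phi [::]).
    by rewrite (_ : [set w | _] = setT) //; apply/seteqP; split.
  by rewrite (_ : [set w | _] = set0) //; apply/seteqP; split.
rewrite split_bits; apply: measurableU; apply: measurableI => //.
exact: measurableC.
Qed.

Variables (F : I -> set_system T) (pr : I -> R).
Hypothesis Fe : forall i, F i [set w | e i w].
Hypothesis FeC : forall i, F i (~` [set w | e i w]).
Hypothesis F_measurable : forall i A, F i A -> measurable A.
Hypothesis F_indep : mutually_independent P F.
Hypothesis e_prob : forall i, P [set w | e i w] = (pr i)%:E.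

(** The events indexed by [J] are those already fixed: the induction on [js] moves one index after
    another into [J], until independence applies to [J] alone. *)
Let prob_bits_cond (J : {fset I}) (A : I -> set T) js (phi : pred (seq bool)) :
  (forall i, i \in J -> F i (A i)) -> uniq js ->
  (forall i, i \in js -> i \notin J) ->
  P (\bigcap_(i in [set` J]) A i `&` [set w | phi [seq e j w | j <- js]]) =
  (\prod_(i <- J) P (A i) * (bits_prob (map pr js) phi)%:E)%E.
Proof.
elim: js J A phi => [|k js IH] J A phi FA.
  move=> _ _ /=; case: (phi [::]).
    rewrite (_ : [set _ : T | true] = setT); last by apply/seteqP; split.
    by rewrite setIT F_indep // mule1.
  rewrite (_ : [set _ : T | false] = set0); last by apply/seteqP; split.
  by rewrite setI0 measure0 mule0.
move=> /= /andP[kjs ujs] jsJ.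
have kJ : k \notin J by apply: jsJ; rewrite mem_head.
have mG : measurable (\bigcap_(i in [set` J]) A i).
  apply: fin_bigcap_measurable; first exact: finite_fset.
  by move=> i /FA /F_measurable.
have step (E : set T) (b : bool) : F k E ->
    P (\bigcap_(i in [set` J]) A i `&`
       (E `&` [set w | (phi \o cons b) [seq e j w | j <- js]])) =
    (\prod_(i <- J) P (A i) * P E * (bits_prob (map pr js) (phi \o cons b))%:E)%E.
  move=> FE; pose A' i := if i == k then E else A i.
  have A'J i : i \in J -> A' i = A i.
    by rewrite /A'; case: eqVneq => // -> kJ'; rewrite kJ' in kJ.
  have A'k : A' k = E by rewrite /A' eqxx.
  have := IH (k |` J)%fset A' (phi \o cons b); rewrite big_fsetU1 //= A'k.
  rewrite (eq_big_seq (fun i => P (A i))); last by move=> i /A'J ->.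
  rewrite [(P E * _)%E]muleC => <- //; last first.
  - move=> i ijs; rewrite !inE negb_or jsJ ?inE ?ijs ?orbT // andbT.
    by apply: contraNneq kjs => <-.
  - move=> i; rewrite !inE /A'; case: eqVneq => [-> //|_ /= /FA]; done.
  congr (P _); rewrite setIA; congr (_ `&` _); apply/seteqP; split => w /=.
    case=> Aw Ew i /=; rewrite !inE => /predU1P[->|iJ]; first by rewrite A'k.
    by rewrite A'J //; apply: Aw.
  move=> Aw; split.
    by move=> i iJ; rewrite -A'J //; apply: Aw; rewrite /= !inE iJ orbT.
  by have := Aw k; rewrite A'k; apply; rewrite /= !inE eqxx.
rewrite (split_bits phi k js) setIUr measureU; last 1 first.
- rewrite -subset0 => w [[_ [ek _]] [_ [nek _]]]; exact: nek.
(* The product is finite, so the conditioning identity reduces to one between reals. *)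
- have [r rE] : exists r, (\prod_(i <- J) P (A i))%E = r%:E.
    exists (fine (P (\bigcap_(i in [set` J]) A i))).
    by rewrite fineK ?fin_num_measure // F_indep.
  rewrite [X in (X + _)%E](step _ true (Fe k)).
  rewrite [X in (_ + X)%E](step _ false (FeC k)).
  rewrite probability_setC // e_prob rE -EFinB -!EFinM -EFinD.
  by congr EFin => /=; ring.
- apply: measurableI => //; apply: measurableI => //.
  exact: (measurable_bits (phi \o cons true)).
- apply: measurableI => //; apply: measurableI; first exact: measurableC.
  exact: (measurable_bits (phi \o cons false)).
Qed.

Lemma prob_bits js (phi : pred (seq bool)) : uniq js ->
  P [set w | phi [seq e j w | j <- js]] = (bits_prob (map pr js) phi)%:E.
Proof.
move=> ujs; have := @prob_bits_cond fset0 (fun=> setT) js phi.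
rewrite big_seq_fset0 mul1e => <- //.
by rewrite set_fset0 bigcap_set0 setTI.
Qed.

End measure_lemmas.

(** * The parking process *)

(** The uniform density is at most 1 everywhere. *)
Lemma uniform_prob_itv (R : realType) (a b : R) : a <= b ->
  (uniform_prob (@ltr01 R) `[a, b[ <= (b - a)%:E)%E.
Proof.
move=> ab; rewrite /uniform_prob.
apply: (@le_trans _ _ (\int[@lebesgue_measure R]_(x in `[a, b[) 1%:E)%E).
  apply: ge0_le_integral => //.
  - by move=> x _; rewrite lee_fin uniform_pdf_ge0.
  - by apply/measurable_EFinP/measurable_funTS; exact: measurable_uniform_pdf.
  - by move=> x _; rewrite lee_fin /uniform_pdf; case: ifP; rewrite ?subr0 ?invr1.
rewrite integral_cst //= mul1e lebesgue_measure_itv /= lte_fin.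
by case: ifP => // _; rewrite lee_fin subr_ge0.
Qed.

Lemma map_cst (S T : Type) (y : T) (l : seq S) :
  [seq y | _ <- l] = nseq (size l) y.
Proof. by elim: l => //= _ l ->. Qed.

Section process.
Context {R : realType} {d : measure_display} {Omega : measurableType d}.
Variable P : probability Omega R.
Variables (X : int -> nat -> {RV P >-> int}) (U : int -> nat -> {RV P >-> R})
  (B : int -> {RV P >-> bool}) (p : R).
Hypothesis H : parking_process X U B p.

(** * Steps and occupations as independent bits *)

Let index := (int * nat + int * nat + int)%type.

(** Marks get the constant bit [true], so that the bits carry the same indices as [sources] and
    inherit [all_independent]. *)
Definition bit (i : index) (w : Omega) : bool :=
  match i with
  | inl (inl (v, s)) => step X v s w == 1
  | inl (inr _) => true
  | inr v => B v w
  end.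

Let bit_law (i : index) : R :=
  match i with inl (inl _) => 2^-1 | inl (inr _) => 1 | inr _ => p end.

(** Decompose over the countably many positions [k] before the step. *)
Lemma measurable_step v s (A : set int) : measurable (step X v s @^-1` A).
Proof.
rewrite (_ : _ @^-1` _ = \bigcup_(k : int)
    (X v s @^-1` [set k] `&` X v s.+1 @^-1` [set m | A (m - k)])).
  apply: countable_bigcupT_measurable; first exact: countableP.
  by move=> k; apply: measurableI; apply: measurable_funPTI.
apply/seteqP; split => w; first by move=> Aw; exists (X v s w).
by case=> k _ [/= <-].
Qed.

Let sources_measurable i A : sources X U B i A -> measurable A.
Proof.
case: i => [[[v s]|[v s]]|v] [C mC <-]; rewrite setTI;
  [exact: measurable_step|exact: measurable_funPTI..].
Qed.

Let sources_bit i : sources X U B i [set w | bit i w].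
Proof.
case: i => [[[v s]|[v s]]|v].
- by exists [set 1] => //; rewrite setTI; apply/seteqP; split => w /= /eqP.
- by exists setT => //; rewrite setTI; apply/seteqP; split.
- by exists [set true] => //; rewrite setTI; apply/seteqP; split => w /=.
Qed.

Let sources_bitC i : sources X U B i (~` [set w | bit i w]).
Proof.
case: i (sources_bit i) => [[[v s]|[v s]]|v] [C mC <-];
  by exists (~` C); [exact: measurableC|rewrite !setTI preimage_setC].
Qed.

Let bit_prob i : P [set w | bit i w] = (bit_law i)%:E.
Proof.
case: i => [[[v s]|[v s]]|v] /=.
- rewrite -(step_right H v s); congr (P _).
  by apply/seteqP; split => w /= /eqP.
- by rewrite (_ : [set w | _] = setT) ?probability_setT //; apply/seteqP; split.
- have := congr1 (fun m => m [set true]) (occupation_law H v).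
  rewrite /= bernoulli_probE ?(parameter_range H) // /distribution /pushforward.
  rewrite !diracE mem_set // memNset // mule1 mule0 adde0 => <-.
  by congr (P _); apply/seteqP; split => w /=.
Qed.

Let prob_bit js (phi : pred (seq bool)) : uniq js ->
  P [set w | phi [seq bit j w | j <- js]] = (bits_prob (map bit_law js) phi)%:E.
Proof.
apply: (prob_bits _ sources_bit sources_bitC sources_measurable
  (all_independent H) bit_prob).
by move=> i; apply: sources_measurable (sources_bit i).
Qed.

Let measurable_bit js (phi : pred (seq bool)) :
  measurable [set w | phi [seq bit j w | j <- js]].
Proof.
apply: measurable_bits => i; exact: sources_measurable (sources_bit i).
Qed.

Let occupied w (l : seq int) := [seq (B v w : bool) | v <- l].

Let occupiedE w l :
  occupied w l = [seq bit j w | j <- [seq inr v | v <- l]].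
Proof. by rewrite -map_comp. Qed.

Let moves w t := [seq step X 0 s w == 1 | s <- iota 0 t].

Let movesE w t :
  moves w t = [seq bit j w | j <- [seq inl (inl (0, s)) | s <- iota 0 t]].
Proof. by rewrite -map_comp. Qed.

Let crowd_prob e k n (phi : pred (seq bool)) :
  measurable [set w | phi (occupied w (sites e k n))] /\
  P [set w | phi (occupied w (sites e k n))] = (bits_prob (nseq n p) phi)%:E.
Proof.
under eq_fun do rewrite occupiedE; split; first exact: measurable_bit.
rewrite prob_bit; last by rewrite map_inj_uniq ?sites_uniq // => ? ? [].
congr (bits_prob _ _)%:E; rewrite -map_comp (@eq_map _ _ _ (fun=> p)) //.
by rewrite map_cst ?size_sites.
Qed.

(** The first alternative of [still_driving], with the walk shifted by [n] so that it starts in the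
    middle of []0, 2 n[]. *)
Let trapped e n t : set Omega :=
  [set w | crowded n 0 0 (occupied w (sites e (n%:Z - 1) (2 * n).-1)) &&
           stays (2 * n) n (moves w t)].

(** Occupations and steps have distinct indices; listing the former first makes the law a
    product. *)
Let trapped_prob e n t : measurable (trapped e n t) /\
  P (trapped e n t) = (bits_prob (nseq (2 * n).-1 p) (crowded n 0 0) *
                       bits_prob (nseq t 2^-1) (stays (2 * n) n))%:E.
Proof.
pose k := (2 * n).-1; pose l : seq index :=
  [seq inr v | v <- sites e (n%:Z - 1) k] ++
  [seq inl (inl (0, s)) | s <- iota 0 t].
pose phi (l : seq bool) := crowded n 0 0 (take k l) && stays (2 * n) n (drop k l).
have -> : trapped e n t = [set w | phi [seq bit j w | j <- l]].
  apply/funext => w; rewrite /trapped /phi /= /l map_cat -occupiedE -movesE.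
  have sk : size (occupied w (sites e (n%:Z - 1) k)) = k.
    by rewrite size_map size_sites.
  by rewrite take_size_cat // drop_size_cat.
split; first exact: measurable_bit.
rewrite prob_bit; last first.
  rewrite cat_uniq map_inj_uniq ?sites_uniq => [|? ? [] //].
  rewrite map_inj_uniq ?iota_uniq ?andbT => [|? ? [] //].
  by apply/hasPn => _ /mapP[s _ ->]; apply/negP => /mapP[].
congr EFin; have -> : map bit_law l = nseq k p ++ nseq t 2^-1.
  rewrite /l map_cat; congr cat; rewrite -map_comp.
    by rewrite (@eq_map _ _ _ (fun=> p)) // map_cst size_sites.
  by rewrite (@eq_map _ _ _ (fun=> 2^-1)) // map_cst size_iota.
by rewrite -bits_prob_cat size_nseq.
Qed.

(** * Null sets *)

(** Equal marks share a cell of length [1/n]. Each of the [n + 1] cells costs at most [1/n^2], in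
    total at most [2/n]. *)
Lemma equal_marks_negligible u v s : u <> v ->
  P.-negligible [set w | U u s w = U v s w].
Proof.
move=> uv; apply: negligible_small => eps eps0.
have [n [n0 ne]] : exists n : nat, (0 < n)%N /\ (2 * n%:R^-1 <= eps :> R).
  exists (Num.truncn (2 / eps)).+1; split => //.
  rewrite ler_pdivrMr // mulrC -ler_pdivrMr // ltW //.
  by have /andP[] := truncn_itv (ltW (divr_gt0 (ltr0n _ 2) eps0) : 0 <= 2 / eps).
have n0' : 0 < n%:R :> R by rewrite ltr0n.
pose cell (k : nat) : set R := `[k%:R / n%:R, k.+1%:R / n%:R[%classic.
pose A k := U u s @^-1` cell k `&` U v s @^-1` cell k.
pose Z := U u s @^-1` (~` `[0, 1]%classic).
have mcell k : measurable (cell k) by exact: measurable_itv.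
have mA k : measurable (A k).
  by apply: measurableI; apply: measurable_funPTI.
have mZ : measurable Z by apply: measurable_funPTI; exact: measurableC.
have PZ : P Z = 0.
  have := mark_law H u s (measurableC (measurable_itv `[0, 1])).
  rewrite /distribution /pushforward => ->.
  by rewrite /uniform_prob integral_uniform_pdf setICl integral_set0.
have Pcell x k : (P (U x s @^-1` cell k) <= (n%:R^-1)%:E)%E.
  have := mark_law H x s (mcell k); rewrite /distribution /pushforward => ->.
  apply: le_trans (uniform_prob_itv _) _.
    by rewrite ler_pM2r ?invr_gt0 // ler_nat.
  by rewrite lee_fin -mulrBl -natr1 addrAC subrr add0r mul1r.
have PA k : (P (A k) <= (n%:R^-1 * n%:R^-1)%:E)%E.
  rewrite (mutually_independent2 (all_independent H) (i := inl (inr (u, s)))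
    (j := inl (inr (v, s)))).
  - by rewrite EFinM; apply: lee_pmul.
  - by apply/eqP => -[].
  - by exists (cell k); rewrite ?setTI.
  - by exists (cell k); rewrite ?setTI.
(* Cells are half-open, so the mark 1 needs the additional cell [k = n]; [Z] takes the marks outside
   [[0, 1]]. *)
exists (Z `|` \big[setU/set0]_(k < n.+1) A k); split.
- by apply: measurableU => //; apply: bigsetU_measurable.
- move=> w /= uw; have [h|h] := pselect (0 <= U u s w <= 1);
    last by left; rewrite /Z /= in_itv.
  right; case/andP: h => x0 x1; rewrite -bigcup_mkord.
  have y0 : 0 <= U u s w * n%:R by rewrite mulr_ge0 // ltW.
  have ck : cell (Num.truncn (U u s w * n%:R)) (U u s w).
    rewrite /cell /= in_itv /= ler_pdivrMr // ltr_pdivlMr //.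
    exact: truncn_itv.
  exists (Num.truncn (U u s w * n%:R)); last by split => //=; rewrite -uw.
  rewrite /= ltnS -(ler_nat R).
  have /andP[h _] := truncn_itv y0; apply: (le_trans h).
  by rewrite ler_piMl // ltW.
- apply: (@le_trans _ _ (P Z + P (\big[setU/set0]_(k < n.+1) A k))%E).
    by apply: measureU2 => //; exact: bigsetU_measurable.
  rewrite PZ add0e; apply: (@le_trans _ _ (\sum_(k < n.+1) P (A k))%E).
    exact: Boole_inequality.
  apply: (@le_trans _ _ (\sum_(k < n.+1) (n%:R^-1 * n%:R^-1)%:E)%E).
    by apply: lee_sum => k _; apply: PA.
  rewrite sumEFin lee_fin sumr_const card_ord -(mulr_natl (_ * _)) mulrA.
  apply: le_trans ne; rewrite ler_pM2r ?invr_gt0 // ler_pdivrMr //.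
  by rewrite -natrM ler_nat; lia.
Qed.

Lemma irregular_step_negligible v s :
  P.-negligible [set w | step X v s w <> 1 /\ step X v s w <> -1].
Proof.
exists (~` (step X v s @^-1` [set 1] `|` step X v s @^-1` [set -1])).
have m := measurable_step v s.
have m2 := measurableU _ _ (m [set 1]) (m [set -1]).
split; [exact: measurableC| |by move=> w [h1 h2] []].
rewrite probability_setC // measureU //.
- rewrite [X in (_ - (X + _))%E](step_right H v s).
  rewrite [X in (_ - (_ + X))%E](step_left H v s).
  by rewrite -EFinD; congr EFin; lra.
- by rewrite -subset0 => w [/= ->].
Qed.

Lemma negligible_bigcup_count (K : countType) (F : K -> set Omega) :
  (forall k, P.-negligible (F k)) -> P.-negligible (\bigcup_k F k).
Proof.
move=> h.
pose G n := if @choice.unpickle K n is Some k then F k else set0.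
have [n|A [mA PA GA]] := @negligible_bigcup _ _ _ P G.
  by rewrite /G; case: (choice.unpickle n) => [k|] //; exact: negligible_set0.
exists A; split => // w [k _ Fw]; apply: GA; exists (choice.pickle k) => //.
by rewrite /G choice.pickleK.
Qed.

(** Where the pathwise hypotheses [X_step] or [U_inj] fail. *)
Let irregular : set Omega :=
  (\bigcup_(i : int * nat)
    [set w | step X i.1 i.2 w <> 1 /\ step X i.1 i.2 w <> -1]) `|`
  \bigcup_(i : int * int * nat)
    [set w | i.1.1 <> i.1.2 /\ U i.1.1 i.2 w = U i.1.2 i.2 w].

Let irregular_negligible : P.-negligible irregular.
Proof.
apply: negligibleU; apply: negligible_bigcup_count.
  by move=> [v s]; exact: irregular_step_negligible.
move=> [[u v] s] /=; have [->|/eqP uv] := eqVneq u v.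
  by apply: negligibleS (negligible_set0 P) => w [].
by apply: negligibleS (equal_marks_negligible s uv) => w [].
Qed.

(** * Estimates below the critical density *)

Hypothesis p_lt : p < 2^-1.
Let dl : R := 2^-1 - p.
(* [z ^ (spaces - cars)] has mean at most [rho] per site. *)
Let z := 1 - dl.
Let rho := 1 - dl ^+ 2.

Let dl_bounds : 0 < dl <= 2^-1.
Proof.
by have /andP[p0 _] := parameter_range H; move: p_lt; rewrite /dl; lra.
Qed.

Let crowd_bound n j c s :
  bits_prob (nseq n p) (crowded j c s) * z ^+ c <= rho ^+ j * z ^+ s.
Proof.
have /andP[d0 d1] := dl_bounds; apply: crowded_prob.
- by have /andP[h1 h2] := parameter_range H; rewrite /is_prob h1.
- by rewrite /z; lra.
- by rewrite /rho; nra.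
(* The right side exceeds the left one by exactly [dl^2 / 2]. *)
- rewrite (_ : p = 2^-1 - dl) /z /rho; last by rewrite /dl; lra.
  by move: (dl) => x; have := sqr_ge0 x; nra.
Qed.

Let overfull t e : set Omega := [set w | forall n : nat,
  crowded (n + 2 * t).+1 (2 * t) 0
    (occupied w (sites e (n + t)%:Z (n + 2 * t).+1))].

(** For fixed [t], the n-th condition has probability at most [rho^(n + 2 t + 1) / z^(2 t)], which
    tends to 0. *)
Let overfull_negligible t e : P.-negligible (overfull t e).
Proof.
have /andP[d0 d1] := dl_bounds.
have z0 : 0 < z by rewrite /z; lra.
have r0 : 0 <= rho by rewrite /rho; nra.
have r1 : rho < 1 by rewrite /rho; nra.
apply: negligible_small => eps eps0.
have [n rn] : exists n, rho ^+ n <= eps * z ^+ (2 * t).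
  have := @cvg_expr R rho; rewrite ger0_norm // => /(_ r1)/cvgrPdist_le.
  move=> /(_ (eps * z ^+ (2 * t))) [|n _ /(_ n (leqnn n)) /=].
    by rewrite mulr_gt0 ?exprn_gt0.
  by rewrite sub0r normrN ger0_norm ?exprn_ge0 // => rn; exists n.
exists [set w | crowded (n + 2 * t).+1 (2 * t) 0
    (occupied w (sites e (n + t)%:Z (n + 2 * t).+1))].
have [m Pe] := crowd_prob e (n + t)%:Z (n + 2 * t).+1
  (crowded (n + 2 * t).+1 (2 * t) 0).
split => //; first by move=> w; apply.
rewrite [leLHS]Pe lee_fin -(ler_pM2r (exprn_gt0 (2 * t) z0)).
apply: le_trans (crowd_bound _ _ _ _) _; rewrite mulr1; apply: le_trans rn.
by rewrite ler_wiXn2l //; [exact: ltW|lia].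
Qed.

(** A single null set, the same for all [t], absorbs the irregular and overfull realisations;
    outside it, [tau > t] forces some [trapped] event. *)
Lemma tau_cover : exists N, [/\ measurable N, P N = 0 &
  forall t w, ~ (N `|` \bigcup_n (trapped true n t `|` trapped false n t)) w ->
    (tau X U B w <= t%:R%:E)%E].
Proof.
have : P.-negligible (irregular `|` \bigcup_(i : nat * bool) overfull i.1 i.2).
  apply: negligibleU irregular_negligible _; apply: negligible_bigcup_count.
  by move=> i; exact: overfull_negligible.
case=> N [mN PN sub]; exists N; split => // t w nw.
have nN : ~ N w by move=> h; apply: nw; left.
have X0 v : X v 0 w = v := walk_start H v w.
have Xs v s : X v s.+1 w - X v s w = 1 \/ X v s.+1 w - X v s w = -1.
  apply: contrapT => /not_orP h; apply: nN; apply: sub; left; left.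
  by exists (v, s).
have Ui s u v : u <> v -> U u s w <> U v s w.
  move=> uv h; apply: nN; apply: sub; left; right.
  by exists (u, v, s).
apply: parking_time_le => dr.
have [e [[n [cr st]]|ov]] := still_driving X0 Xs Ui dr; last first.
  by apply: nN; apply: sub; right; exists (t, e).
apply: nw; right; exists n => //.
suff : trapped e n t w by case: (e); [left|right].
rewrite /trapped /=; apply/andP; split; first exact: cr.
have := @stays_walk (fun v s => X v s w) Xs n 0 0 t.
by rewrite X0 add0r absz_nat; apply => s /andP[_]; rewrite add0n; apply: st.
Qed.

Lemma tau_integral_le : (\int[P]_w tau X U B w <= (4 * dl ^- 6)%:E)%E.
Proof.
have /andP[d0 d1] := dl_bounds.
have r0 : 0 <= rho by rewrite /rho; nra.
have r1 : rho < 1 by rewrite /rho; nra.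
have [N [mN PN cover]] := tau_cover.
have mtr t n : measurable (trapped true n t `|` trapped false n t).
  exact: (measurableU _ _ (trapped_prob true n t).1 (trapped_prob false n t).1).
have mt t : measurable (\bigcup_n (trapped true n t `|` trapped false n t)).
  exact: bigcupT_measurable.
pose wk n t := bits_prob (nseq t 2^-1 : seq R) (stays (2 * n) n).
have wk0 n t : 0 <= wk n t.
  by apply: bits_prob_ge0; rewrite all_nseq /is_prob; apply/orP; right; lra.
(* The factor 2 accounts for the two sides [e]. *)
pose a t n : \bar R := (2 * rho ^+ n * wk n t)%:E.
have a0 t n : (0 <= a t n)%E by rewrite lee_fin !mulr_ge0 ?exprn_ge0.
have Pt t : (P (N `|` \bigcup_n (trapped true n t `|` trapped false n t))
    <= \sum_(0 <= n <oo) a t n)%E.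
  apply: (le_trans (measureU2 _ mN (mt t))).
  rewrite [X in (X + _ <= _)%E]PN add0e.
  apply: (le_trans (generalized_Boole_inequality _ (mtr t) (mt t))).
  apply: lee_nneseries => // n _;
  apply: (le_trans (measureU2 _ (trapped_prob true n t).1
    (trapped_prob false n t).1)).
  rewrite [X in (X + _ <= _)%E](trapped_prob true n t).2.
  rewrite [X in (_ + X <= _)%E](trapped_prob false n t).2.
  have := crowd_bound (2 * n).-1 n 0 0; rewrite !expr0 !mulr1 => hc.
  rewrite -EFinD lee_fin -/(wk n t); have := ler_wpM2r (wk0 n t) hc; lra.
have tau0 w : (0 <= tau X U B w)%E.
  rewrite /tau /parking_time; case: ifP => // _.
  by apply: le_ereal_inf_tmp => _ [s _ <-]; rewrite lee_fin.
have mE t : measurable (N `|`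
    \bigcup_n (trapped true n t `|` trapped false n t)).
  exact: measurableU.
apply: (le_trans (integral_tail_sum P tau0 mE cover)).
apply: (@le_trans _ _ (\sum_(0 <= t <oo) \sum_(0 <= n <oo) a t n)%E).
  by apply: lee_nneseries.
(* Summing over [t] first turns the survival probabilities of the walk into its mean exit time. *)
rewrite nneseries_interchange //.
apply: (@le_trans _ _ (\sum_(0 <= n <oo) (2 * rho ^+ n * (n * n)%:R)%:E)%E).
  apply: lee_nneseries => [n _ _|n _]; first exact: nneseries_ge0.
  apply: nneseries_le => // T; rewrite sumEFin lee_fin -mulr_sumr.
  apply: ler_wpM2l; first by rewrite mulr_ge0 ?exprn_ge0.
  (* Gambler's ruin with [M = 2 n], started at the midpoint [n]. *)
  rewrite big_mkord (_ : (n * n = n * (2 * n - n))%N);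
    last by rewrite mul2n -addnn addnK.
  by apply: stays_time; rewrite leq_pmull.
apply: nneseries_le => [n|T]; first by rewrite lee_fin !mulr_ge0 ?exprn_ge0.
rewrite sumEFin lee_fin big_mkord.
under eq_bigr do rewrite -mulrA.
rewrite -mulr_sumr.
have := @sum_sq_geo R rho T; rewrite r0 r1 => /(_ isT).
(* The cube in the geometric bound becomes the sixth power of [dl]. *)
have -> : 1 - rho = dl ^+ 2 by rewrite /rho; ring.
rewrite -exprM => h; have -> : 4 * dl ^- 6 = 2 * (2 / dl ^+ (2 * 3)).
  by rewrite mulrA; congr (_ * _); ring.
by rewrite ler_pM2l.
Qed.

End process.

Theorem theorem1p4 (R : realType) :
  (forall (d : measure_display) (Omega : measurableType d)
      (P : probability Omega R) (X : int -> nat -> {RV P >-> int})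
      (U : int -> nat -> {RV P >-> R}) (B : int -> {RV P >-> bool}) (p : R),
    parking_process X U B p -> p < 2^-1 ->
    (\int[P]_w tau X U B w < +oo)%E) /\
  (exists C : R, \forall p \near (2^-1 : R)^'-,
    forall (d : measure_display) (Omega : measurableType d)
      (P : probability Omega R) (X : int -> nat -> {RV P >-> int})
      (U : int -> nat -> {RV P >-> R}) (B : int -> {RV P >-> bool}),
    parking_process X U B p ->
    (\int[P]_w tau X U B w <= (C * (2^-1 - p) ^- 6)%:E)%E).
Proof.
split=> [d Omega P X U B p H p_lt|].
  exact: le_lt_trans (tau_integral_le H p_lt) (ltry _).
(* The bound with constant 4 holds for every [p < 1/2], which is all that is asked of nearness. *)
exists 4; near=> p => d Omega P X U B H.
apply: (tau_integral_le H); near: p; exact: nbhs_left_lt.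
Unshelve. all: by end_near.
Qed.
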